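(* For all formulas $\alpha,\beta,\delta$: (1) $\alpha\vDash\alpha$; (2) if $\alpha\vDash\beta$ and $\beta\vDash\delta$, then $\alpha\vDash\delta$.
   Context: Hilbert spaces and states: for $n\ge1$, $\mathcal H^{(n)}=(\mathbb C^2)^{\otimes n}$ with canonical basis $|x_1,\dots,x_n\rangle$ ($x_i\in\{0,1\}$, $|0\rangle=(1,0)$, $|1\rangle=(0,1)$); $\mathfrak D(\mathcal H^{(n)})$ is the set of density operators (qumixes). A truth-perspective is a unitary $\mathfrak T$ on $\mathbb C^2$, $\mathfrak T^{(n)}=\mathfrak T^{\otimes n}$. $^{\mathfrak T}P_1^{(n)}$ (resp. $^{\mathfrak T}P_0^{(n)}$) is the projection onto the span of the $\mathfrak T^{(n)}|x_1,\dots,x_n\rangle$ with $x_n=1$ (resp. $0$). $\mathtt p_{\mathfrak T}(\rho)=\mathrm{tr}(^{\mathfrak T}P_1^{(n)}\rho)$ for $\rho\in\mathfrak D(\mathcal H^{(n)})$, and $\rho\preceq_{\mathfrak T}\sigma$ iff $\mathtt p_{\mathfrak T}(\rho)\le\mathtt p_{\mathfrak T}(\sigma)$. $Red^{(j_1,\dots,j_s)}_{[n_1,\dots,n_t]}(\rho)$ is the reduced state of $\rho$ on factors $j_1,\dots,j_s$ of $\mathcal H^{(n_1)}\otimes\cdots\otimes\mathcal H^{(n_t)}$. Gates (canonical basis, extended linearly): $\mathtt{NOT}^{(n)}|x_1..x_n\rangle=|x_1..x_{n-1}\rangle\otimes|1-x_n\rangle$; $\sqrt{\mathtt I}^{(n)}|x_1..x_n\rangle=|x_1..x_{n-1}\rangle\otimes\frac1{\sqrt2}((-1)^{x_n}|x_n\rangle+|1-x_n\rangle)$;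 $\sqrt{\mathtt{NOT}}^{(n)}|x_1..x_n\rangle=|x_1..x_{n-1}\rangle\otimes(\frac{1-i}2|x_n\rangle+\frac{1+i}2|1-x_n\rangle)$; $\mathtt{XOR}^{(m,n)}|x_1..x_m,y_1..y_n\rangle=|x_1..x_m,y_1..y_{n-1}\rangle\otimes|x_m\oplus y_n\rangle$; $\mathtt T^{(m,n,p)}|x_1..x_m,y_1..y_n,z_1..z_p\rangle=|x_1..x_m,y_1..y_n,z_1..z_{p-1}\rangle\otimes|x_my_n\oplus z_p\rangle$ ($\oplus$ addition mod 2). For a gate $G$ on $\mathcal H^{(n)}$: $G_{\mathfrak T}=\mathfrak T^{(n)}G\mathfrak T^{(n)\dagger}$, $^{\mathfrak D}G_{\mathfrak T}(\rho)=G_{\mathfrak T}\rho G_{\mathfrak T}^\dagger$. Language: formulas built from atomic formulas (including distinguished atoms $\mathbf t,\mathbf f$) with unary $\lnot,\sqrt{id},\sqrt\lnot$, binary $\uplus$, ternary $\intercal$. $At(\alpha)$ = number of occurrences of atomic formulas in $\alpha$. Syntactical tree: $Level_1^\alpha=(\alpha)$; $Level_{i+1}^\alpha$ is obtained from $Level_i^\alpha=(\beta_1,\dots,\beta_r)$ by replacing each non-atomic $\beta_j$ by its immediate subformulas (arguments, in order) and keeping atomic $\beta_j$; the last level $Level_h^\alpha$ lists all atomic occurrences. $\mathcal H^{(At\alpha)}=\bigotimes_j\mathcal H^{(At\beta_j)}$. The $\mathfrak T$-gate $G^\alpha_{\mathfrak T(i)}$ ($1\le i<h$) is the tensor product over $j$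 of: identity of $\mathbb C^2$ if $\beta_j$ atomic; $\mathtt{NOT}_{\mathfrak T}^{(At\beta)}$, $\sqrt{\mathtt I}_{\mathfrak T}^{(At\beta)}$, $\sqrt{\mathtt{NOT}}_{\mathfrak T}^{(At\beta)}$ for $\lnot\beta,\sqrt{id}\beta,\sqrt\lnot\beta$; $\mathtt{XOR}_{\mathfrak T}^{(At\beta',At\beta'')}$ for $\beta'\uplus\beta''$; $\mathtt T_{\mathfrak T}^{(At\beta',At\beta'',At\beta''')}$ for $\intercal(\beta',\beta'',\beta''')$. Holistic model: a map $\mathtt{Hol}_{\mathfrak T}$ assigning to each level $Level_i^\alpha$ of each formula $\alpha$ a qumix in $\mathfrak D(\mathcal H^{(At\alpha)})$ such that (a) $\mathtt{Hol}_{\mathfrak T}(Level_i^\alpha)={}^{\mathfrak D}G^\alpha_{\mathfrak T(i)}(\mathtt{Hol}_{\mathfrak T}(Level_{i+1}^\alpha))$ for $1\le i<h$; (b) (normality) for each $\gamma$, with the contextual meaning of the occurrence $\beta_j$ in $Level_i^\gamma=(\beta_1,\dots,\beta_r)$ defined as $Red^{(j)}_{[At\beta_1,\dots,At\beta_r]}(\mathtt{Hol}_{\mathfrak T}(Level_i^\gamma))$, all occurrences of the same subformula $\beta$ in the tree of $\gamma$ have the same contextual meaning, denoted $\mathtt{Hol}^\gamma_{\mathfrak T}(\beta)$; (c) every occurrence of $\mathbf f$ (resp. $\mathbf t$) has contextual meaning $^{\mathfrak T}P_0^{(1)}$ (resp. $^{\mathfrak T}P_1^{(1)}$). Logical consequence: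 $\alpha\vDash\beta$ iff for every truth-perspective $\mathfrak T$, every formula $\gamma$ having both $\alpha$ and $\beta$ as subformulas (a formula counts as a subformula of itself), and every holistic model $\mathtt{Hol}_{\mathfrak T}$, $\mathtt{Hol}^\gamma_{\mathfrak T}(\alpha)\preceq_{\mathfrak T}\mathtt{Hol}^\gamma_{\mathfrak T}(\beta)$. *)

(* Defs.v *)
From mathcomp Require Import all_boot all_algebra.
From mathcomp Require Import complex.
From mathcomp Require Import Rstruct.
Set Implicit Arguments. Unset Strict Implicit. Unset Printing Implicit Defensive.
Import GRing.Theory Num.Theory.
Local Open Scope ring_scope.

Definition C : numClosedFieldType := (Rdefinitions.R)[i].

Inductive formula : Type :=
  | Atom of nat
  | Ft
  | Ff
  | Neg of formula
  | SqId of formula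
  | SqNeg of formula
  | Xr of formula & formula
  | Tf of formula & formula & formula.

Fixpoint At (a : formula) : nat :=
  match a with
  | Atom _ | Ft | Ff => 1
  | Neg b | SqId b | SqNeg b => At b
  | Xr b c => At b + At c
  | Tf b c d => At b + At c + At d
  end.

Definition is_atomic (a : formula) : bool :=
  match a with Atom _ | Ft | Ff => true | _ => false end.

Inductive subf (b : formula) : formula -> Prop :=
  | subf_refl : subf b b
  | subf_Neg g : subf b g -> subf b (Neg g)
  | subf_SqId g : subf b g -> subf b (SqId g)
  | subf_SqNeg g : subf b g -> subf b (SqNeg g)
  | subf_Xr1 g h : subf b g -> subf b (Xr g h)
  | subf_Xr2 g h : subf b h -> subf b (Xr g h)
  | subf_Tf1 g h k : subf b g -> subf b (Tf g h k)
  | subf_Tf2 g h k : subf b h -> subf b (Tf g h k)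
  | subf_Tf3 g h k : subf b k -> subf b (Tf g h k).

Definition step (a : formula) : seq formula :=
  match a with
  | Atom _ | Ft | Ff => [:: a]
  | Neg b | SqId b | SqNeg b => [:: b]
  | Xr b c => [:: b; c]
  | Tf b c d => [:: b; c; d]
  end.

Definition expand (l : seq formula) : seq formula := flatten (map step l).

Definition level (a : formula) (i : nat) : seq formula :=
  iter i.-1 expand [:: a].

(* height h of the syntactical tree: Level_h is the first level consisting
   only of atomic formulas *)
Fixpoint height (a : formula) : nat :=
  match a with
  | Atom _ | Ft | Ff => 1
  | Neg b | SqId b | SqNeg b => (height b).+1
  | Xr b c => (maxn (height b) (height c)).+1
  | Tf b c d => (maxn (height b) (maxn (height c) (height d))).+1
  end.

(* Linear algebra on H^(n) = (C^2)^{⊗ n}, matrices 'M[C]_(2^n).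
   The canonical basis vector |x_1,...,x_n> has index sum_k x_k 2^(n-k)
   (x_1 most significant), which is the Kronecker-product ordering.     *)

Definition adj N (A : 'M[C]_N) : 'M[C]_N := (map_mx Num.conj A)^T.

Definition unitary N (A : 'M[C]_N) : Prop := A *m adj A = 1%:M.

Definition adjv N (v : 'cV[C]_N) : 'rV[C]_N := (map_mx Num.conj v)^T.

Definition psd N (A : 'M[C]_N) : Prop :=
  forall v : 'cV[C]_N, 0 <= (adjv v *m A *m v) 0 0.

Definition density N (A : 'M[C]_N) : Prop := psd A /\ \tr A = 1.

Definition mxf N (A : 'M[C]_N) (i j : nat) : C :=
  match (insub i : option 'I_N), (insub j : option 'I_N) with
  | Some i', Some j' => A i' j'
  | _, _ => 0
  end.

(* single-qubit operator U acting on the last factor of H^(n) *)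
Definition lastU n (U : 'M[C]_2) : 'M[C]_(2 ^ n) :=
  \matrix_(i, j) (if ((i : nat) %/ 2 == (j : nat) %/ 2)%N
                  then U (inord ((i : nat) %% 2)%N) (inord ((j : nat) %% 2)%N) else 0).

Definition permg N (g : nat -> nat) : 'M[C]_N :=
  \matrix_(i, j) ((i : nat) == g (j : nat))%N%:R.

(* flip the last qubit: x_n |-> 1 - x_n *)
Definition flip (j : nat) : nat := if odd j then j.-1 else j.+1.

Definition NOTg n : 'M[C]_(2 ^ n) := permg (2 ^ n) flip.

Definition sqrtI_1 : 'M[C]_2 :=
  \matrix_(i, j) ((if ((i : nat) == 1%N) && ((j : nat) == 1%N) then -1 else 1)
                  / sqrtC 2).
Definition sqrtIg n : 'M[C]_(2 ^ n) := lastU n sqrtI_1.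

Definition sqrtNOT_1 : 'M[C]_2 :=
  \matrix_(i, j) (if i == j then (1 - 'i) / 2 else (1 + 'i) / 2).
Definition sqrtNOTg n : 'M[C]_(2 ^ n) := lastU n sqrtNOT_1.

(* XOR^(m,n): target y_n (weight 1), control x_m (weight 2^n) *)
Definition XORg m n : 'M[C]_(2 ^ (m + n)) :=
  permg _ (fun j => if odd (j %/ 2 ^ n)%N then flip j else j).

(* Toffoli T^(m,n,p): target z_p, controls x_m (weight 2^(n+p)),
   y_n (weight 2^p) *)
Definition Toffg m n p : 'M[C]_(2 ^ (m + n + p)) :=
  permg _ (fun j => if odd (j %/ 2 ^ (n + p))%N && odd (j %/ 2 ^ p)%N
                    then flip j else j).

(* T^(n) = T^{⊗ n}, written entrywise *)
Definition Tn (T : 'M[C]_2) n : 'M[C]_(2 ^ n) :=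
  \matrix_(i, j) \prod_(k < n)
      T (inord ((i : nat) %/ 2 ^ k %% 2)%N) (inord ((j : nat) %/ 2 ^ k %% 2)%N).

Definition conjT (T : 'M[C]_2) n (G : 'M[C]_(2 ^ n)) : 'M[C]_(2 ^ n) :=
  Tn T n *m G *m adj (Tn T n).

(* projections onto the span of T^(n)|x> with x_n = 1 (resp. 0) *)
Definition P1 n : 'M[C]_(2 ^ n) := \matrix_(i, j) ((i == j) && odd i)%:R.
Definition P0 n : 'M[C]_(2 ^ n) := \matrix_(i, j) ((i == j) && ~~ odd i)%:R.
Definition TP1 T n := conjT T (P1 n).
Definition TP0 T n := conjT T (P0 n).

Definition pT (T : 'M[C]_2) n (rho : 'M[C]_(2 ^ n)) : C := \tr (TP1 T n *m rho).

Definition gate_of (T : 'M[C]_2) (b : formula) : 'M[C]_(2 ^ At b) :=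
  match b as b0 return 'M[C]_(2 ^ At b0) with
  | Atom _ | Ft | Ff => 1%:M
  | Neg c => conjT T (NOTg (At c))
  | SqId c => conjT T (sqrtIg (At c))
  | SqNeg c => conjT T (sqrtNOTg (At c))
  | Xr c d => conjT T (XORg (At c) (At d))
  | Tf c d e => conjT T (Toffg (At c) (At d) (At e))
  end.

(* index of the k-th factor of u in H^(n_1) ⊗ ... ⊗ H^(n_t), ns = [n_1..n_t]
   (k counted from 0) *)
Definition blk (ns : seq nat) (k u : nat) : nat :=
  ((u %/ 2 ^ sumn (drop k.+1 ns)) %% 2 ^ nth 0 ns k)%N.

(* tensor product of the gates of the formulas of Level_i^a *)
Definition Glev (T : 'M[C]_2) (a : formula) (i : nat) : 'M[C]_(2 ^ At a) :=
  let l := level a i in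
  let ns := map At l in
  \matrix_(u, v) \prod_(k < size l)
      mxf (gate_of T (nth Ff l k)) (blk ns k u) (blk ns k v).

(* Red^(k)_[ns](rho) (partial trace over all factors but the k-th),
   as a matrix on H^(m) (m = nth 0 ns k) *)
Definition red (ns : seq nat) (k : nat) N (rho : 'M[C]_N) m : 'M[C]_(2 ^ m) :=
  \matrix_(a, b) \sum_(u < N) \sum_(v < N)
     (if [&& (blk ns k u == a)%N, (blk ns k v == b)%N &
            all (fun l => (l == k)%N || (blk ns l u == blk ns l v)%N)
                (iota 0 (size ns))]
      then rho u v else 0).

(* candidate holistic maps: Level_i^a |-> Hol a i *)
Definition holmap := forall a : formula, nat -> 'M[C]_(2 ^ At a).

(* contextual meaning of the j-th (from 0) occurrence of Level_i^g,
   seen as an operator on H^(m) *)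
Definition ctx (Hol : holmap) (g : formula) (i j m : nat) : 'M[C]_(2 ^ m) :=
  red (map At (level g i)) j (Hol g i) m.

Definition pos (g : formula) (i j : nat) : Prop :=
  [/\ (1 <= i)%N, (i <= height g)%N & (j < size (level g i))%N].

Definition holistic (T : 'M[C]_2) (Hol : holmap) : Prop :=
  [/\ (forall a i, (1 <= i <= height a)%N -> density (Hol a i)),
      (forall a i, (1 <= i < height a)%N ->
          Hol a i = Glev T a i *m Hol a i.+1 *m adj (Glev T a i)),
      (forall g b i j i' j', pos g i j -> pos g i' j' ->
          nth Ff (level g i) j = b -> nth Ff (level g i') j' = b ->
          ctx Hol g i j (At b) = ctx Hol g i' j' (At b))
    & (forall g i j, pos g i j ->
          (nth Ff (level g i) j = Ff -> ctx Hol g i j 1 = TP0 T 1) /\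
          (nth Ff (level g i) j = Ft -> ctx Hol g i j 1 = TP1 T 1))].

Definition consequence (a b : formula) : Prop :=
  forall T : 'M[C]_2, unitary T ->
  forall g : formula, subf a g -> subf b g ->
  forall Hol : holmap, holistic T Hol ->
  forall i j i' j', pos g i j -> pos g i' j' ->
    nth Ff (level g i) j = a -> nth Ff (level g i') j' = b ->
    pT T (ctx Hol g i j (At a)) <= pT T (ctx Hol g i' j' (At b)).

(* Main.v *)
(* Reflexivity is normality. The difficulty of transitivity is that the middle
   formula b need not occur in a given formula g containing a and d, so the
   hypotheses have to be applied in another formula, with another holistic model
   that keeps the contextual meanings of a and d.

   Given a model Hol and a formula g, assign to every formula c a state rho c: its
   contextual meaning in g if c occurs in the tree of g, and otherwise the image
   under the gate of c of the tensor product of the states of its immediate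
   subformulas. In both cases the reduced states of gate(c)^dagger rho(c) gate(c)
   are the states of the immediate subformulas: in the first case because gates
   act locally and Hol is normal, in the second because the state is a product.
   Starting from rho f at the root of any formula f and pulling back through the
   (unitary) level gates therefore yields a holistic model in which every
   occurrence of c, in every formula, has meaning rho c. Evaluating both hypotheses
   in the formula T(a, b, d) gives the conclusion. *)
Require Import Defs.
From mathcomp Require Import all_boot all_order all_algebra.
From mathcomp Require Import spectral boolp ring zify.
Set Implicit Arguments. Unset Strict Implicit. Unset Printing Implicit Defensive.
Import Order.TTheory GRing.Theory Num.Theory.
Local Open Scope ring_scope.

(** * Indices of a product space, encoded as [p * M + s] *)

Lemma ltn_pair p s N M : (p < N)%N -> (s < M)%N -> (p * M + s < N * M)%N.
Proof.
by move=> ltp lts; apply: leq_trans (leq_mul ltp (leqnn M)); rewrite mulSn addnC ltn_add2r.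
Qed.

Definition pair_ord N M (p : 'I_N) (s : 'I_M) : 'I_(N * M) :=
  Ordinal (ltn_pair (ltn_ord p) (ltn_ord s)).

Lemma sum_mul_ord (V : nmodType) N M (F : 'I_(N * M) -> V) :
  \sum_k F k = \sum_p \sum_s F (pair_ord p s).
Proof.
pose F' k := if insub k is Some u then F u else 0.
have F'E (u : 'I_(N * M)) : F' u = F u by rewrite /F' valK.
under eq_bigr do rewrite -F'E.
rewrite -(big_mkord xpredT F') big_nat_mul big_mkord; apply: eq_bigr => p _.
rewrite -{1}[(p * M)%N]add0n big_addn mulSn addnK big_mkord.
by apply: eq_bigr => s _; rewrite -F'E addnC.
Qed.

Lemma divn_pair p s M : (s < M)%N -> ((p * M + s) %/ M = p)%N.
Proof. by move=> lts; rewrite divnMDl ?(leq_ltn_trans _ lts) // divn_small ?addn0. Qed.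

Lemma modn_pair p s M : (s < M)%N -> ((p * M + s) %% M = s)%N.
Proof. by move=> lts; rewrite modnMDl modn_small. Qed.

Lemma sum_delta (V : nmodType) N (i : nat) (F : nat -> V) :
  (i < N)%N -> \sum_(k < N) (if k == i :> nat then F k else 0) = F i.
Proof.
move=> lti; rewrite -big_mkcond (big_pred1 (Ordinal lti)) //.
Qed.

(** * Kernels, Kronecker products and partial traces *)

Section Kernels.

Variable K : numClosedFieldType.

(* Matrices indexed by natural numbers: only the entries below the dimension, which
   is passed to each operation separately, are meaningful. This avoids casts between
   the types ['M_(2 ^ n)] when tensor factors are regrouped. *)
Definition kernel := nat -> nat -> K.

Implicit Types A B D G f h : kernel.

(** [M] is the dimension of the right factor: quotient and remainder by [M] are the indices in the
    two factors. *)
Definition kron M (A B : kernel) : kernel :=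
  fun u v => A (u %/ M)%N (v %/ M)%N * B (u %% M)%N (v %% M)%N.

Lemma kron_pair M A B a b s t : (s < M)%N -> (t < M)%N ->
  kron M A B (a * M + s)%N (b * M + t)%N = A a b * B s t.
Proof. by move=> hs ht; rewrite /kron !divn_pair // !modn_pair. Qed.

(** This is A^† A = 1 below [N], the form in which an operator on a traced-out factor cancels. *)
Definition isometric N (A : kernel) := forall i j, (i < N)%N -> (j < N)%N ->
  \sum_(k < N) (A k i)^* * A k j = (i == j)%:R.

Definition conjk N (G h : kernel) : kernel :=
  fun a b => \sum_(u < N) \sum_(v < N) G a u * h u v * (G b v)^*.

(* Partial traces over the right factor of N * Q, resp. the left factor of P * N. *)
Definition ptrR Q (f : kernel) : kernel :=
  fun a b => \sum_(s < Q) f (a * Q + s)%N (b * Q + s)%N.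

Definition ptrL P N (f : kernel) : kernel :=
  fun a b => \sum_(p < P) f (p * N + a)%N (p * N + b)%N.

Definition trk N (f : kernel) := \sum_(i < N) f i i.

Definition psdk N (f : kernel) := forall v : nat -> K,
  0 <= \sum_(i < N) \sum_(j < N) (v i)^* * f i j * v j.

Definition eqk N (f h : kernel) :=
  forall i j, (i < N)%N -> (j < N)%N -> f i j = h i j.

Lemma kron_isometry N M A B :
  isometric N A -> isometric M B -> isometric (N * M)%N (kron M A B).
Proof.
move=> iA iB i j hi hj.
have M0 : (0 < M)%N by case: M hi {hj iB} => //; rewrite muln0.
have di : (i %/ M < N)%N by rewrite ltn_divLR.
have dj : (j %/ M < N)%N by rewrite ltn_divLR.
rewrite sum_mul_ord.
transitivity (\sum_(p < N) (A p (i %/ M)%N)^* * A p (j %/ M)%N *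
    \sum_(s < M) (B s (i %% M)%N)^* * B s (j %% M)%N).
  apply: eq_bigr => p _; rewrite mulr_sumr; apply: eq_bigr => s _.
  by rewrite /kron divn_pair // modn_pair // rmorphM /= mulrACA.
rewrite -mulr_suml iA // iB ?ltn_mod // -natrM mulnb; congr (_%:R).
congr nat_of_bool; apply/andP/eqP => [[/eqP e1 /eqP e2]|->] //.
by rewrite (divn_eq i M) (divn_eq j M) e1 e2.
Qed.

(** Tracing out the right factor contracts the two copies of [D] into D^† D = 1, so only [A] still
    acts on the reduced kernel. *)
Lemma ptrR_conj N Q A D h : isometric Q D ->
  eqk N (ptrR Q (conjk (N * Q)%N (kron Q A D) h)) (conjk N A (ptrR Q h)).
Proof.
move=> iD a b _ _; rewrite /ptrR /conjk.
(* The traced index [s] is moved innermost, where it forms the isometry sum of [D]. *)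
transitivity (\sum_(x < N) \sum_(t < Q) \sum_(y < N) \sum_(t' < Q)
   (A a x * h (x * Q + t)%N (y * Q + t')%N * (A b y)^*) *
   \sum_(s < Q) (D s t')^* * D s t).
  under eq_bigr do rewrite sum_mul_ord.
  rewrite exchange_big; apply: eq_bigr => x _.
  rewrite exchange_big; apply: eq_bigr => t _.
  under eq_bigr do rewrite sum_mul_ord.
  rewrite exchange_big; apply: eq_bigr => y _.
  rewrite exchange_big; apply: eq_bigr => t' _.
  rewrite mulr_sumr; apply: eq_bigr => s _.
  by rewrite !kron_pair // rmorphM /=; ring.
apply: eq_bigr => x _; rewrite exchange_big; apply: eq_bigr => y _.
rewrite mulr_sumr mulr_suml; apply: eq_bigr => t _.
rewrite -[RHS](@sum_delta _ Q t (fun t' => A a x * h (x * Q + t)%N (y * Q + t')%N * (A b y)^*)) //.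
by apply: eq_bigr => t' _; rewrite iD //; case: eqP => _; rewrite ?mulr1 ?mulr0.
Qed.

Lemma ptrL_conj P N A B h : isometric P A ->
  eqk N (ptrL P N (conjk (P * N)%N (kron N A B) h)) (conjk N B (ptrL P N h)).
Proof.
move=> iA a b ha hb; rewrite /ptrL /conjk.
transitivity (\sum_(t < P) \sum_(x < N) \sum_(t' < P) \sum_(y < N)
   (B a x * h (t * N + x)%N (t' * N + y)%N * (B b y)^*) *
   \sum_(s < P) (A s t')^* * A s t).
  under eq_bigr do rewrite sum_mul_ord.
  rewrite exchange_big; apply: eq_bigr => x _.
  rewrite exchange_big; apply: eq_bigr => t _.
  under eq_bigr do rewrite sum_mul_ord.
  rewrite exchange_big; apply: eq_bigr => y _.
  rewrite exchange_big; apply: eq_bigr => t' _.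
  rewrite mulr_sumr; apply: eq_bigr => s _.
  by rewrite !kron_pair // rmorphM /=; ring.
rewrite exchange_big; apply: eq_bigr => x _.
under eq_bigr do rewrite exchange_big.
rewrite exchange_big; apply: eq_bigr => y _.
rewrite mulr_sumr mulr_suml; apply: eq_bigr => t _.
rewrite -[RHS](@sum_delta _ P t (fun t' => B a x * h (t * N + x)%N (t' * N + y)%N * (B b y)^*)) //.
by apply: eq_bigr => t' _; rewrite iA //; case: eqP => _; rewrite ?mulr1 ?mulr0.
Qed.

Lemma ptrR_kron N Q A D : eqk N (ptrR Q (kron Q A D)) (fun a b => A a b * trk Q D).
Proof.
by move=> a b _ _; rewrite /ptrR mulr_sumr; apply: eq_bigr => s _; rewrite kron_pair.
Qed.

Lemma ptrL_kron P N A B : eqk N (ptrL P N (kron N A B)) (fun a b => trk P A * B a b).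
Proof.
by move=> a b ha hb; rewrite /ptrL mulr_suml; apply: eq_bigr => s _; rewrite kron_pair.
Qed.

Lemma trk_kron N M A B : trk (N * M)%N (kron M A B) = trk N A * trk M B.
Proof.
rewrite /trk sum_mul_ord mulr_suml; apply: eq_bigr => p _.
by rewrite mulr_sumr; apply: eq_bigr => s _; rewrite kron_pair.
Qed.

Lemma trk_ptrR N Q f : trk N (ptrR Q f) = trk (N * Q)%N f.
Proof. by rewrite /trk sum_mul_ord. Qed.

Lemma trk_ptrL P N f : trk N (ptrL P N f) = trk (P * N)%N f.
Proof. by rewrite /trk sum_mul_ord exchange_big. Qed.

Lemma ptrR_ptrR Q1 Q2 f : ptrR Q1 (ptrR Q2 f) = ptrR (Q1 * Q2)%N f.
Proof.
apply/funext => a; apply/funext => b.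
rewrite /ptrR sum_mul_ord; apply: eq_bigr => s1 _; apply: eq_bigr => s2 _.
by rewrite !mulnDl !mulnA !addnA.
Qed.

Lemma ptrL_ptrL P1 P2 N f :
  ptrL P2 N (ptrL P1 (P2 * N)%N f) = ptrL (P1 * P2)%N N f.
Proof.
apply/funext => a; apply/funext => b.
rewrite /ptrL sum_mul_ord exchange_big; apply: eq_bigr => s1 _; apply: eq_bigr => s2 _.
by rewrite !mulnDl !mulnA !addnA.
Qed.

Lemma ptrR_ptrL P N Q f :
  ptrR Q (ptrL P (N * Q)%N f) = ptrL P N (ptrR Q f).
Proof.
apply/funext => a; apply/funext => b.
rewrite /ptrR /ptrL exchange_big; apply: eq_bigr => p _; apply: eq_bigr => s _.
by rewrite !mulnDl !mulnA !addnA.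
Qed.

Lemma eqk_ptrR N Q f h : eqk (N * Q)%N f h -> eqk N (ptrR Q f) (ptrR Q h).
Proof.
by move=> e a b ha hb; apply: eq_bigr => s _; apply: e; apply: ltn_pair.
Qed.

Lemma eqk_ptrL P N f h : eqk (P * N)%N f h -> eqk N (ptrL P N f) (ptrL P N h).
Proof.
by move=> e a b ha hb; apply: eq_bigr => s _; apply: e; apply: ltn_pair.
Qed.

Lemma eqk_conj N G G' h h' : eqk N G G' -> eqk N h h' -> eqk N (conjk N G h) (conjk N G' h').
Proof.
move=> eG eh a b ha hb; apply: eq_bigr => u _; apply: eq_bigr => v _.
by rewrite !eG // eh.
Qed.

Lemma eqk_trans N f h k : eqk N f h -> eqk N h k -> eqk N f k.
Proof. by move=> e1 e2 a b ha hb; rewrite e1 // e2. Qed.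

Lemma eqk_sym N f h : eqk N f h -> eqk N h f.
Proof. by move=> e a b ha hb; rewrite e. Qed.

Lemma eqk_trk N f h : eqk N f h -> trk N f = trk N h.
Proof. by move=> e; apply: eq_bigr => i _; apply: e. Qed.

Lemma eqk_psd N f h : eqk N f h -> psdk N f -> psdk N h.
Proof.
move=> e pf v; have := pf v; congr (0 <= _).
by apply: eq_bigr => i _; apply: eq_bigr => j _; rewrite e.
Qed.

Lemma eqk_isometry N f h : eqk N f h -> isometric N f -> isometric N h.
Proof.
move=> e pf i j hi hj; rewrite -pf //.
by apply: eq_bigr => k _; rewrite !e.
Qed.

Lemma ptrR_psd N Q f : psdk (N * Q)%N f -> psdk N (ptrR Q f).
Proof.
move=> pf v.
rewrite (_ : \sum_(i < N) _ = \sum_(s < Q) \sum_(i < N) \sum_(j < N)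
   (v i)^* * f (i * Q + s)%N (j * Q + s)%N * v j); last first.
  rewrite [RHS]exchange_big; apply: eq_bigr => i _; rewrite [RHS]exchange_big.
  by apply: eq_bigr => j _; rewrite mulr_sumr mulr_suml.
apply: sumr_ge0 => s _.
(* The test vector is v ⊗ e_s; summing over [s] gives the quadratic form of the partial trace at
   [v]. *)
have := pf (fun u => if (u %% Q)%N == s then v (u %/ Q)%N else 0).
congr (0 <= _); rewrite sum_mul_ord; apply: eq_bigr => i _.
rewrite -[RHS](@sum_delta _ Q s (fun s => \sum_(j < N)
   (v i)^* * f (i * Q + s)%N (j * Q + s)%N * v j)) //.
apply: eq_bigr => s1 _; rewrite modn_pair // divn_pair //.
case: eqP => [e|_]; last first.
  by apply: big1 => j _; rewrite rmorph0 !mul0r.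
rewrite sum_mul_ord /= e; apply: eq_bigr => j _.
rewrite -[RHS](@sum_delta _ Q s (fun t => (v i)^* * f (i * Q + s)%N (j * Q + t)%N * v j)) //.
apply: eq_bigr => t _; rewrite modn_pair // divn_pair //=.
by case: eqP => // _; rewrite mulr0.
Qed.

Lemma ptrL_psd P N f : psdk (P * N)%N f -> psdk N (ptrL P N f).
Proof.
move=> pf v.
rewrite (_ : \sum_(i < N) _ = \sum_(s < P) \sum_(i < N) \sum_(j < N)
   (v i)^* * f (s * N + i)%N (s * N + j)%N * v j); last first.
  rewrite [RHS]exchange_big; apply: eq_bigr => i _; rewrite [RHS]exchange_big.
  by apply: eq_bigr => j _; rewrite mulr_sumr mulr_suml.
apply: sumr_ge0 => s _.
(* Here the test vector is e_s ⊗ v. *)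
have := pf (fun u => if (u %/ N)%N == s then v (u %% N)%N else 0).
congr (0 <= _); rewrite sum_mul_ord.
rewrite -[RHS](@sum_delta _ P s (fun s => \sum_(i < N) \sum_(j < N)
   (v i)^* * f (s * N + i)%N (s * N + j)%N * v j)) //.
apply: eq_bigr => s1 _; case: eqP => [e|ne].
  apply: eq_bigr => i _; rewrite modn_pair // divn_pair // e eqxx sum_mul_ord /= e.
  rewrite -[RHS](@sum_delta _ P s (fun t =>
    \sum_(j < N) (v i)^* * f (s * N + i)%N (t * N + j)%N * v j)) //.
  apply: eq_bigr => t _; case: eqP => [e'|net].
    by apply: eq_bigr => j _; rewrite modn_pair // divn_pair // e' eqxx.
  by apply: big1 => j _; rewrite divn_pair //; case: eqP => // _; rewrite mulr0.
apply: big1 => i _; rewrite divn_pair //; case: eqP => // _.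
by apply: big1 => j _; rewrite rmorph0 !mul0r.
Qed.

Lemma diag_bool_psd N (c : nat -> bool) : psdk N (fun i j => ((i == j) && c i)%:R).
Proof.
move=> v; apply: sumr_ge0 => i _.
rewrite (bigD1 i) //= big1 => [|j ne].
  rewrite addr0 eqxx /=; case: (c i); rewrite ?(mulr1, mulr0, mul0r) //.
  by rewrite mulrC mul_conjC_ge0.
case: (i =P j :> nat) => [e|_]; last by rewrite mulr0 mul0r.
by rewrite (ord_inj e) eqxx in ne.
Qed.

(** The reduced kernel on the middle factor of a space of dimension P N Q. *)
Definition ptrk P N Q f := ptrL P N (ptrR Q f).

Lemma eqk_ptrk P N Q f h : eqk (P * N * Q)%N f h -> eqk N (ptrk P N Q f) (ptrk P N Q h).
Proof. by move=> e; apply/eqk_ptrL/eqk_ptrR. Qed.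

(** Locality of gates: isometries on the outer factors are invisible in the reduced state of the
    middle one. *)
Lemma ptrk_conj P N Q A B D h : isometric P A -> isometric Q D ->
  eqk N (ptrk P N Q (conjk (P * N * Q)%N (kron Q (kron N A B) D) h))
    (conjk N B (ptrk P N Q h)).
Proof.
move=> iA iD; refine (eqk_trans _ (ptrL_conj B (ptrR Q h) iA)).
exact/eqk_ptrL/ptrR_conj.
Qed.

Lemma ptrk_ptrk P1 P2 N Q1 Q2 f :
  ptrk P2 N Q1 (ptrk P1 (P2 * N * Q1)%N Q2 f) = ptrk (P1 * P2)%N N (Q1 * Q2)%N f.
Proof. by rewrite /ptrk ptrR_ptrL ptrL_ptrL ptrR_ptrR. Qed.

Lemma ptrk_kron P N Q A B D : trk P A = 1 -> trk Q D = 1 ->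
  eqk N (ptrk P N Q (kron Q (kron N A B) D)) B.
Proof.
move=> tA tD; refine (eqk_trans (eqk_ptrL (ptrR_kron Q (kron N A B) D)) _) => a b ha hb.
transitivity (trk P A * B a b); last by rewrite tA mul1r.
rewrite -(@ptrL_kron P N A B) //.
by apply: eq_bigr => p _; rewrite tD mulr1.
Qed.

Definition densk N f := psdk N f /\ trk N f = 1.

Lemma ptrk_dens P N Q f : densk (P * N * Q)%N f -> densk N (ptrk P N Q f).
Proof.
by case=> pf tf; split; [apply/ptrL_psd/ptrR_psd | rewrite trk_ptrL trk_ptrR].
Qed.

Lemma eqk_dens N f h : eqk N f h -> densk N f -> densk N h.
Proof.
by move=> e [pf tf]; split; [apply: eqk_psd pf | rewrite -(eqk_trk e)].
Qed.

Lemma kronA M N A B D :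
  kron N (kron M A B) D = kron (M * N) A (kron N B D).
Proof.
apply/funext => u; apply/funext => v.
have e w : (w %% (M * N) %% N = w %% N)%N by rewrite modn_dvdm // dvdn_mull.
by rewrite /kron mulrA !e -!modn_divl [(M * N)%N]mulnC !divnMA.
Qed.

Lemma kron_psd_term (a b c d e w : K) :
  a * (b * (c * d) * e) * w = b * (c * d) * (a * e * w).
Proof. by ring. Qed.

Lemma kron_psd_term' (a b c d e w : K) :
  a * (b * c * d * (e * w)) = a * (b * e) * (c * d * w).
Proof. by ring. Qed.

End Kernels.

(** * Positive semidefinite matrices and their tensor products *)

Lemma quad_form N (A : 'M[C]_N) (v : 'cV[C]_N) :
  (adjv v *m A *m v) 0 0 = \sum_i \sum_j (v i 0)^* * A i j * v j 0.
Proof.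
rewrite mxE exchange_big; apply: eq_bigr => j _.
by rewrite mxE mulr_suml; apply: eq_bigr => i _; rewrite !mxE.
Qed.

Lemma adjmx_mul N (A B : 'M[C]_N) : adj (A *m B) = adj B *m adj A.
Proof. by rewrite /adj map_mxM trmx_mul. Qed.

Lemma adjmxK N (A : 'M[C]_N) : adj (adj A) = A.
Proof. by apply/matrixP => i j; rewrite !mxE conjCK. Qed.

Lemma adjv_mul N (A : 'M[C]_N) (v : 'cV[C]_N) : adjv (A *m v) = adjv v *m adj A.
Proof. by rewrite /adjv map_mxM trmx_mul. Qed.

(* Polarization with the vectors e_i + c e_j, for c = 1 and c = 'i. *)
Lemma quad_form_eq0 N (B : 'M[C]_N) :
  (forall v : 'cV[C]_N, (adjv v *m B *m v) 0 0 = 0) -> B = 0.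
Proof.
move=> q0; apply/matrixP => i j; rewrite mxE.
have E (k l : 'I_N) : (delta_mx 0 k *m B *m delta_mx l 0 : 'M_1) 0 0 = B k l.
  by rewrite -rowE -colE !mxE.
have D (k : 'I_N) : adjv (delta_mx k 0) = delta_mx 0 k :> 'rV[C]_N.
  by apply/matrixP => x y; rewrite !mxE rmorph_nat andbC.
have d0 k : B k k = 0 by rewrite -(q0 (delta_mx k 0)) D E.
have F c : c * B i j + c^* * B j i = 0.
  have := q0 (delta_mx i 0 + c *: delta_mx j 0).
  have -> : adjv (delta_mx i 0 + c *: delta_mx j 0) =
            delta_mx 0 i + c^* *: delta_mx 0 j :> 'rV[C]_N.
    by rewrite -!D; apply/matrixP => x y; rewrite !mxE rmorphD rmorphM.
  rewrite !mulmxDl !mulmxDr -!scalemxAl -!scalemxAr mxE [X in X + _]mxE.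
  rewrite [X in _ + X]mxE.
  rewrite ![(_ *: _ : 'M_1) 0 0]mxE !E !d0 !mulr0 !addr0 add0r => <-.
  by rewrite addrC.
have F1 := F 1; have Fi := F 'i.
rewrite conjCi in Fi; rewrite rmorph1 !mul1r in F1.
move/eqP: Fi; rewrite mulNr -mulrBr mulf_eq0 (negPf (neq0Ci _)) /= subr_eq0.
move/eqP=> e; move: F1; rewrite -e -mulr2n => /eqP.
by rewrite mulrn_eq0 /= => /eqP.
Qed.

(** In [C], being nonnegative includes being real. The quadratic form of [A] thus equals its
    conjugate, which is the form of [adj A], and polarization separates matrices by their forms. *)
Lemma psd_hermitian N (A : 'M[C]_N) : psd A -> adj A = A.
Proof.
move=> pA; apply/eqP; rewrite -subr_eq0; apply/eqP.
apply: quad_form_eq0 => v.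
rewrite mulmxBr mulmxBl mxE [X in _ + X]mxE !quad_form; apply/eqP.
have /geC0_conj := pA v; rewrite quad_form subr_eq0 => <-.
rewrite rmorph_sum exchange_big; apply/eqP/eq_bigr => i _.
rewrite rmorph_sum; apply: eq_bigr => j _.
by rewrite !rmorphM /= conjCK !mxE mulrC [X in _ * X]mulrC mulrA.
Qed.

(** Spectral theorem: [A] is hermitian, hence normal. The coefficients are its eigenvalues, and [X]
    is the unitary matrix that diagonalizes it. *)
Lemma psd_sum_rank1 N (A : 'M[C]_N) : psd A ->
  exists lam : 'I_N -> C, exists X : 'M[C]_N,
    (forall k, 0 <= lam k) /\
    forall i j, A i j = \sum_k lam k * ((X k i)^* * X k j).
Proof.
move=> pA; have hA := psd_hermitian pA.
have nA : A \is normalmx.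
  by apply/normalmxP; move: hA; rewrite /adj map_trmx => ->.
have /orthomx_spectralP eA := nA.
set P := spectralmx A in eA; set sp := spectral_diag A in eA.
have uP : P \is unitarymx := spectral_unitarymx A.
have iP : invmx P = adj P by rewrite invmx_unitary // /adj map_trmx.
have PP : P *m adj P = 1%:M by rewrite -iP mulmxV // unitarymx_unit.
exists (fun k => sp 0 k), P; split=> [k|i j].
  (* The k-th column of P^† is an eigenvector, at which the quadratic form takes the k-th
     eigenvalue. *)
  have := pA (adj P *m delta_mx k 0).
  rewrite adjv_mul adjmxK {1}eA iP !mulmxA.
  rewrite -[_ *m P *m adj P]mulmxA PP mulmx1 -[_ *m P *m adj P]mulmxA PP mulmx1.
  rewrite (_ : adjv _ = delta_mx 0 k); last first.
    by apply/matrixP => x y; rewrite !mxE rmorph_nat andbC.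
  by rewrite -rowE -colE !mxE eqxx.
rewrite {1}eA iP mul_mx_diag mxE; apply: eq_bigr => k _.
by rewrite !mxE mulrAC mulrC.
Qed.

Lemma psdk_psd N (f : kernel C) : psdk N f <-> psd (\matrix_(i < N, j < N) f i j).
Proof.
split=> [pf v | pf v].
  have := pf (fun k => if insub k is Some i then v i 0 else 0).
  rewrite quad_form; congr (0 <= _); apply: eq_bigr => i _; apply: eq_bigr => j _.
  by rewrite !valK mxE.
have := pf (\col_(i < N) v i).
rewrite quad_form; congr (0 <= _); apply: eq_bigr => i _; apply: eq_bigr => j _.
by rewrite !mxE.
Qed.

(** Decomposing [A] into rank-one terms turns the form of A ⊗ B at [v] into a nonnegative
    combination of values of the form of [B], at the contractions of [v] with the rows of [X]. *)
Lemma kron_psd N M (A B : kernel C) :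
  psdk N A -> psdk M B -> psdk (N * M) (kron M A B).
Proof.
move=> /psdk_psd/psd_sum_rank1[lam [X [lam0 eA]]] pB v.
have eA' (i j : 'I_N) : A i j = \sum_k lam k * ((X k i)^* * X k j) by rewrite -eA mxE.
rewrite (_ : \sum_i _ = \sum_k lam k * \sum_(s < M) \sum_(t < M)
   (\sum_i X k i * v (i * M + s)%N)^* * B s t * (\sum_j X k j * v (j * M + t)%N)).
  by apply: sumr_ge0 => k _; apply: mulr_ge0 => //;
    exact: (pB (fun s => \sum_i X k i * v (i * M + s)%N)).
rewrite sum_mul_ord.
under [RHS]eq_bigr do rewrite mulr_sumr.
rewrite [RHS]exchange_big [LHS]exchange_big; apply: eq_bigr => s _.
under [RHS]eq_bigr do rewrite mulr_sumr.
under [LHS]eq_bigr do rewrite sum_mul_ord exchange_big.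
rewrite [RHS]exchange_big [LHS]exchange_big; apply: eq_bigr => t _.
rewrite [RHS](eq_bigr (fun k => \sum_i \sum_j
  lam k * ((X k i)^* * X k j) * ((v (i * M + s)%N)^* * B s t * v (j * M + t)%N))).
  rewrite [RHS]exchange_big; apply: eq_bigr => i _.
  rewrite [RHS]exchange_big; apply: eq_bigr => j _.
  rewrite /= kron_pair // eA' !mulr_suml !mulr_sumr ?mulr_suml.
  by apply: eq_bigr => k _; rewrite kron_psd_term.
move=> k _; rewrite rmorph_sum !mulr_suml mulr_sumr; apply: eq_bigr => i _.
rewrite mulr_sumr mulr_sumr; apply: eq_bigr => j _.
by rewrite rmorphM kron_psd_term'.
Qed.

(** * Passage between matrices and kernels *)

Lemma mxfE N (A : 'M[C]_N) (i j : 'I_N) : mxf A i j = A i j.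
Proof. by rewrite /mxf !valK. Qed.

Lemma eqk_ord N (f h : kernel C) : (forall i j : 'I_N, f i j = h i j) -> eqk N f h.
Proof. by move=> e i j hi hj; apply: (e (Ordinal hi) (Ordinal hj)). Qed.

Lemma mxf_matrix N (f : kernel C) : eqk N (mxf (\matrix_(i < N, j < N) f i j)) f.
Proof. by apply: eqk_ord => i j; rewrite mxfE mxE. Qed.

Lemma mxf_inj N (A B : 'M[C]_N) : eqk N (mxf A) (mxf B) -> A = B.
Proof. by move=> e; apply/matrixP => i j; rewrite -!mxfE e. Qed.

Lemma mxf_conj N (G X : 'M[C]_N) :
  eqk N (mxf (G *m X *m adj G)) (conjk N (mxf G) (mxf X)).
Proof.
apply: eqk_ord => i j; rewrite mxfE mxE /conjk exchange_big; apply: eq_bigr => v _.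
by rewrite mxE mulr_suml; apply: eq_bigr => u _; rewrite !mxE !mxfE.
Qed.

Lemma unitary_adj N (A : 'M[C]_N) : unitary A -> adj A *m A = 1%:M.
Proof. exact: mulmx1C. Qed.

(** [unitary] says A A^† = 1 and [isometric] says A^† A = 1; for square matrices a one-sided inverse
    is two-sided. *)
Lemma unitary_isometry N (A : 'M[C]_N) : unitary A <-> isometric N (mxf A).
Proof.
have E : adj A *m A = 1%:M <-> isometric N (mxf A).
  split=> [/matrixP e i j hi hj|e].
    have := e (Ordinal hi) (Ordinal hj); rewrite !mxE -val_eqE /= => <-.
    by apply: eq_bigr => k _; rewrite !mxE -!mxfE.
  apply/matrixP => i j; rewrite !mxE -val_eqE /= -(e i j) //.
  by apply: eq_bigr => k _; rewrite !mxE !mxfE.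
by split=> [/mulmx1C/E|/E/mulmx1C].
Qed.

Lemma unitary_mul N (A B : 'M[C]_N) : unitary A -> unitary B -> unitary (A *m B).
Proof.
move=> uA uB; rewrite /unitary adjmx_mul mulmxA -[A *m B *m _]mulmxA uB mulmx1.
exact: uA.
Qed.

Lemma unitary1 N : unitary (1%:M : 'M[C]_N).
Proof. by rewrite /unitary /adj map_scalar_mx rmorph1 tr_scalar_mx mulmx1. Qed.

Lemma adj_unitary N (A : 'M[C]_N) : unitary A -> unitary (adj A).
Proof. by move=> uA; rewrite /unitary adjmxK; apply: unitary_adj. Qed.

(** * Unitarity of the gates *)

(** An involution permutes the basis vectors, so the columns are distinct basis vectors, hence
    orthonormal. *)
Lemma unitary_permg N (g : nat -> nat) :
  (forall i, (i < N)%N -> (g i < N)%N /\ g (g i) = i) -> unitary (permg N g).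
Proof.
move=> hg; apply/unitary_isometry => i j hi hj.
have [gi ggi] := hg i hi; have [gj ggj] := hg j hj.
rewrite -[RHS](@sum_delta _ N (g i) (fun => (i == j)%:R)) //.
apply: eq_bigr => k _.
have -> : mxf (permg N g) k i = (k == g i :> nat)%:R.
  by rewrite (mxfE _ k (Ordinal hi)) mxE.
have -> : mxf (permg N g) k j = (k == g j :> nat)%:R.
  by rewrite (mxfE _ k (Ordinal hj)) mxE.
case: eqP => [->|_]; rewrite ?rmorph0 ?mul0r // rmorph1 mul1r.
by congr (nat_of_bool _)%:R; apply/eqP/eqP => [e|->//]; rewrite -ggi e ggj.
Qed.

Lemma flip_pair p (b : bool) : flip (p * 2 + b) = (p * 2 + ~~ b)%N.
Proof. by rewrite /flip muln2 oddD odd_double oddb; case: b => /=; rewrite ?addn0 ?addn1. Qed.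

Lemma ltn_flip M j : (j < M * 2)%N -> (flip j < M * 2)%N.
Proof.
rewrite (divn_eq j 2) modn2 flip_pair => h.
have := h; rewrite -ltn_divLR // divn_pair ?ltnS ?leq_b1 // => h'.
by apply: ltn_pair => //; case: (odd j).
Qed.

Lemma flipK j : flip (flip j) = j.
Proof. by rewrite (divn_eq j 2) modn2 !flip_pair negbK. Qed.

Lemma divn2_flip j : (flip j %/ 2 = j %/ 2)%N.
Proof.
by rewrite {1}(divn_eq j 2) modn2 flip_pair divn_pair //; case: (odd j).
Qed.

Lemma divn_flip_exp j n : (0 < n)%N -> (flip j %/ 2 ^ n = j %/ 2 ^ n)%N.
Proof. by case: n => // n _; rewrite expnS !divnMA divn2_flip. Qed.

Lemma unitary_NOTg n : (0 < n)%N -> unitary (NOTg n).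
Proof.
case: n => // n _; apply: unitary_permg => i; rewrite expnSr => hi.
by split; [apply: ltn_flip | apply: flipK].
Qed.

(** A control that does not read the target bit is unchanged by [flip], so the controlled flip is
    again an involution. This covers XOR and Toffoli. *)
Lemma unitary_cond_flip n (c : nat -> bool) :
  (0 < n)%N -> (forall j, c (flip j) = c j) ->
  unitary (permg (2 ^ n) (fun j => if c j then flip j else j)).
Proof.
case: n => // n _ hc; apply: unitary_permg => i; rewrite expnSr => hi.
by case E : (c i); rewrite ?hc E ?flipK; split => //; apply: ltn_flip.
Qed.

Lemma unitary_XORg m n : (0 < n)%N -> unitary (XORg m n).
Proof.
move=> n0; apply: (unitary_cond_flip (c := fun j => odd (j %/ 2 ^ n))).
  by rewrite addn_gt0 n0 orbT.
by move=> j; rewrite divn_flip_exp.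
Qed.

Lemma unitary_Toffg m n p : (0 < p)%N -> unitary (Toffg m n p).
Proof.
move=> p0; apply: (unitary_cond_flip
  (c := fun j => odd (j %/ 2 ^ (n + p)) && odd (j %/ 2 ^ p))).
  by rewrite addn_gt0 p0 orbT.
by move=> j; rewrite !divn_flip_exp // addn_gt0 p0 orbT.
Qed.

Lemma isometry1 N : isometric N (fun i j => (i == j)%:R : C).
Proof.
move=> i j hi hj.
rewrite -[RHS](@sum_delta _ N i (fun => (i == j)%:R)) //.
apply: eq_bigr => k _; case: (k =P i :> nat) => [->|_]; last by rewrite rmorph0 mul0r.
by rewrite rmorph1 mul1r.
Qed.

Lemma mxf_inord (U : 'M[C]_2) i j : (i < 2)%N -> (j < 2)%N ->
  mxf U i j = U (inord i) (inord j).
Proof. by move=> hi hj; rewrite -mxfE !inordK. Qed.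

Lemma unitary_lastU n (U : 'M[C]_2) : (0 < n)%N -> unitary U -> unitary (lastU n U).
Proof.
case: n => // n _ /unitary_isometry uU; apply/unitary_isometry.
(* [lastU] is 1 ⊗ U, the last qubit being the least significant bit. *)
have hI : isometric (2 ^ n.+1) (kron 2 (fun i j => (i == j)%:R) (mxf U)).
  by rewrite expnSr; apply: kron_isometry => //; apply: isometry1.
apply: eqk_isometry hI; apply: eqk_ord => i j; rewrite mxfE mxE /kron.
case: eqP => _; rewrite ?mul0r ?mul1r // mxf_inord ?ltn_mod //.
Qed.

Lemma unitary_Tn T n : unitary T -> unitary (Tn T n).
Proof.
move=> uT; apply/unitary_isometry; elim: n => [|n IHn].
  apply/unitary_isometry; rewrite (_ : Tn T 0 = 1%:M); first exact: unitary1.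
  by apply/matrixP => i j; rewrite !mxE big_ord0 !ord1.
(* T^(n+1) = T^(n) ⊗ T: the factor k = 0 of the entrywise product reads the last qubit. *)
have hI : isometric (2 ^ n.+1) (kron 2 (mxf (Tn T n)) (mxf T)).
  by rewrite expnSr; apply: kron_isometry => //; apply/unitary_isometry.
apply: eqk_isometry hI; apply: eqk_ord => i j; rewrite mxfE mxE /kron.
have di (k : 'I_(2 ^ n.+1)) : (k %/ 2 < 2 ^ n)%N by rewrite ltn_divLR // -expnSr.
rewrite (mxfE _ (Ordinal (di i)) (Ordinal (di j))) mxE mxf_inord ?ltn_mod //.
rewrite big_ord_recl !expn0 !divn1 mulrC; congr (_ * _).
by apply: eq_bigr => k _; rewrite /= /bump /= add1n -!divnMA -!expnS.
Qed.

Lemma unitary_conjT T n (G : 'M[C]_(2 ^ n)) :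
  unitary T -> unitary G -> unitary (conjT T G).
Proof.
move=> uT uG; have uTn := unitary_Tn n uT.
by apply: unitary_mul; [apply: unitary_mul | apply: adj_unitary].
Qed.

Lemma unitary_sqrtI_1 : unitary sqrtI_1.
Proof.
apply/matrixP => i j; rewrite !mxE big_ord_recl big_ord1 !mxE /=.
have s2 : sqrtC 2 != 0 :> C by rewrite sqrtC_eq0 pnatr_eq0.
have c2 : (sqrtC 2 : C)^* = sqrtC 2.
  by apply: geC0_conj; rewrite sqrtC_ge0 ler0n.
have q2 : (sqrtC 2 : C)^-1 * (sqrtC 2)^-1 = 2^-1.
  by rewrite -invfM -expr2 sqrtCK.
have h2 : 2^-1 + 2^-1 = 1 :> C by rewrite [RHS]splitr mul1r.
rewrite !rmorphM !fmorphV /= !c2.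
by case: i j => [[|[|//]] hi] [[|[|//]] hj] /=;
  rewrite ?(rmorphN, rmorph1) ?(mulN1r, mul1r, mulrN, mulNr, opprK) q2 ?subrr ?h2.
Qed.

Lemma sqrtNOT_diag (K : numClosedFieldType) :
  (1 - 'i) / 2 * ((1 + 'i) / 2) + (1 + 'i) / 2 * ((1 - 'i) / 2) = 1 :> K.
Proof.
transitivity ((1 - 'i ^+ 2) / 2 : K); first by field.
by rewrite sqrCi opprK -[1 + 1]/(2%:R) divff ?pnatr_eq0.
Qed.

Lemma sqrtNOT_offdiag (K : numClosedFieldType) :
  (1 - 'i) / 2 * ((1 - 'i) / 2) + (1 + 'i) / 2 * ((1 + 'i) / 2) = 0 :> K.
Proof.
transitivity ((1 + 'i ^+ 2) / 2 : K); first by field.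
by rewrite sqrCi subrr mul0r.
Qed.

Lemma unitary_sqrtNOT_1 : unitary sqrtNOT_1.
Proof.
(* Conjugation swaps the two coefficients, so the four entries of U U^† reduce to two identities. *)
have c1 : ((1 - 'i) / 2 : C)^* = (1 + 'i) / 2.
  by rewrite rmorphM fmorphV rmorphB rmorph1 rmorph_nat /= conjCi opprK.
have c2 : ((1 + 'i) / 2 : C)^* = (1 - 'i) / 2 by rewrite -c1 conjCK.
apply/matrixP => i j; rewrite !mxE big_ord_recl big_ord1 !mxE -!val_eqE /=.
case: i j => [[|[|//]] hi] [[|[|//]] hj] /=; rewrite ?c1 ?c2.
- exact: (sqrtNOT_diag C).
- exact: (sqrtNOT_offdiag C).
- by rewrite addrC; exact: (sqrtNOT_offdiag C).
- by rewrite addrC; exact: (sqrtNOT_diag C).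
Qed.

Lemma At_gt0 a : (0 < At a)%N.
Proof. by elim: a => //= *; rewrite !addn_gt0; apply/orP; left => //; apply/orP; left. Qed.

Lemma unitary_gate_of T b : unitary T -> unitary (gate_of T b).
Proof.
move=> uT; case: b => [n|||b|b|b|b c|b c d] /=; try exact: unitary1;
  apply: unitary_conjT => //.
- exact/unitary_NOTg/At_gt0.
- by apply: unitary_lastU; [apply: At_gt0 | apply: unitary_sqrtI_1].
- by apply: unitary_lastU; [apply: At_gt0 | apply: unitary_sqrtNOT_1].
- exact/unitary_XORg/At_gt0.
- exact/unitary_Toffg/At_gt0.
Qed.

(** * Tensor products along the levels of a tree *)

(* A list of pairs (number of qubits, operator) stands for the factors of a tensor
   product. *)
Definition tdim (l : seq (nat * kernel C)) : nat := 2 ^ sumn (unzip1 l).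

Fixpoint tens (l : seq (nat * kernel C)) : kernel C :=
  if l is (_, A) :: l' then kron (tdim l') A (tens l') else fun _ _ => 1.

Lemma tdim_cons n A l : tdim ((n, A) :: l) = (2 ^ n * tdim l)%N.
Proof. by rewrite /tdim /= expnD. Qed.

Lemma tdim_cat l1 l2 : tdim (l1 ++ l2) = (tdim l1 * tdim l2)%N.
Proof. by rewrite /tdim /unzip1 map_cat sumn_cat expnD. Qed.

Lemma tdim_gt0 l : (0 < tdim l)%N.
Proof. by rewrite expn_gt0. Qed.

(** The restriction to indices below the dimension matters already for empty [l1], where the
    remainder by [tdim l2] must give back the index. *)
Lemma tens_cat l1 l2 :
  eqk (tdim (l1 ++ l2)) (tens (l1 ++ l2)) (kron (tdim l2) (tens l1) (tens l2)).
Proof.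
elim: l1 => [|[n A] l1 IH] u v hu hv /=.
  by rewrite /kron mul1r !modn_small.
by rewrite kronA -tdim_cat /kron IH ?ltn_mod ?tdim_gt0.
Qed.

Lemma tens_isometry l : List.Forall (fun x => isometric (2 ^ x.1) x.2) l ->
  isometric (tdim l) (tens l).
Proof.
elim=> [|[n A] {}l iA _ IH].
  rewrite (_ : tdim [::] = 1%N) // => -[|//] [|//] _ _.
  by rewrite big_ord1 rmorph1 mul1r.
by rewrite tdim_cons; apply: kron_isometry.
Qed.

Lemma tens_dens l : List.Forall (fun x => densk (2 ^ x.1) x.2) l ->
  densk (tdim l) (tens l).
Proof.
elim=> [|[n A] {}l [pA tA] _ [pl tl]].
  rewrite (_ : tdim [::] = 1%N) //.
  split=> [v|]; last by rewrite /trk big_ord1.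
  by rewrite !big_ord1 /= mulr1 mulrC mul_conjC_ge0.
rewrite tdim_cons; split; first exact: kron_psd.
by rewrite /= trk_kron tA tl mulr1.
Qed.

Lemma tens_single n A : eqk (2 ^ n) (tens [:: (n, A)]) A.
Proof. by move=> u v _ _; rewrite /= /kron /tdim /= !divn1 mulr1. Qed.

Lemma tens_cat3 l1 n A l2 : eqk (tdim (l1 ++ (n, A) :: l2))
  (tens (l1 ++ (n, A) :: l2)) (kron (tdim l2) (kron (2 ^ n) (tens l1) A) (tens l2)).
Proof. by rewrite kronA -(tdim_cons n A l2); apply: tens_cat. Qed.

(** * Block indices and reduced states as partial traces *)

Lemma blk_catL n1 n2 k u : (k < size n1)%N ->
  blk (n1 ++ n2) k u = blk n1 k (u %/ 2 ^ sumn n2).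
Proof.
move=> hk; rewrite /blk nth_cat hk drop_cat.
case: ltnP => [_|h].
  by rewrite sumn_cat addnC expnD divnMA.
have e : k.+1 = size n1 by apply/eqP; rewrite eqn_leq hk h.
by rewrite e subnn drop0 drop_size divn1.
Qed.

Lemma blk_catR n1 n2 k u : (k < size n2)%N ->
  blk (n1 ++ n2) (size n1 + k) u = blk n2 k (u %% 2 ^ sumn n2).
Proof.
move=> hk; rewrite /blk nth_cat ltnNge leq_addr /= addKn -addnS.
rewrite drop_cat ltnNge leq_addr /= addKn.
rewrite -{3}(cat_take_drop k n2) (drop_nth 0 hk) sumn_cat /= !expnD.
set D := (2 ^ sumn (drop _ _))%N; set B := (2 ^ nth _ _ _)%N.
rewrite mulnA -modn_divl [RHS]modn_dvdm // dvdn_mull //.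
Qed.

(** The blocks are the digits of an index in the mixed radix given by [ns], so they determine it. *)
Lemma blk_inj ns u v : (u < 2 ^ sumn ns)%N -> (v < 2 ^ sumn ns)%N ->
  all (fun l => blk ns l u == blk ns l v) (iota 0 (size ns)) = (u == v).
Proof.
elim: ns u v => [|n ns IH] u v hu hv.
  by move: hu hv; case: u v => [|//] [|//].
have b0 w : (w < 2 ^ sumn (n :: ns))%N ->
    blk (n :: ns) 0 w = (w %/ 2 ^ sumn ns)%N.
  move=> hw; rewrite /blk /= drop0 modn_small // ltn_divLR ?expn_gt0 //.
  by rewrite -expnD.
rewrite /= !b0 // -[1%N]addn0 iotaDl all_map.
rewrite (@eq_in_all _ _ (fun l =>
  blk ns l (u %% 2 ^ sumn ns) == blk ns l (v %% 2 ^ sumn ns))); last first.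
  move=> l; rewrite mem_iota => /andP[_ hl].
  by rewrite /= -!(@blk_catR [:: n] ns).
rewrite IH ?ltn_mod ?expn_gt0 //; apply/andP/eqP => [[/eqP e1 /eqP e2]|->] //.
by rewrite (divn_eq u (2 ^ sumn ns)) (divn_eq v (2 ^ sumn ns)) e1 e2.
Qed.

Lemma divn_triple p x s M Q : (x < M)%N -> (s < Q)%N ->
  (((p * M + x) * Q + s) %/ (M * Q) = p)%N.
Proof. by move=> hx hs; rewrite [(M * Q)%N]mulnC divnMA !divn_pair. Qed.

Lemma blk_at n1 m n2 p x s : (x < 2 ^ m)%N -> (s < 2 ^ sumn n2)%N ->
  blk (n1 ++ m :: n2) (size n1) ((p * 2 ^ m + x) * 2 ^ sumn n2 + s) = x.
Proof.
move=> hx hs; rewrite -[size n1]addn0 blk_catR // /blk /= drop0 expnD.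
by rewrite -modn_divl modn_mod divn_pair // modn_pair.
Qed.

Lemma blk_others n1 m n2 p x s p' x' s' :
  (p < 2 ^ sumn n1)%N -> (x < 2 ^ m)%N -> (s < 2 ^ sumn n2)%N ->
  (p' < 2 ^ sumn n1)%N -> (x' < 2 ^ m)%N -> (s' < 2 ^ sumn n2)%N ->
  all (fun l => (l == size n1)%N || (blk (n1 ++ m :: n2) l ((p * 2 ^ m + x) * 2 ^ sumn n2 + s)
        == blk (n1 ++ m :: n2) l ((p' * 2 ^ m + x') * 2 ^ sumn n2 + s'))%N)
    (iota 0 (size (n1 ++ m :: n2))) = (p == p') && (s == s').
Proof.
move=> hp hx hs hp' hx' hs'.
rewrite size_cat iotaD all_cat add0n /= eqxx /=.
rewrite -(blk_inj hp hp') -(blk_inj hs hs'); congr (_ && _).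
  apply: eq_in_all => l; rewrite mem_iota /= add0n => hl.
  by rewrite (ltn_eqF hl) /= !blk_catL //= expnD !divn_triple.
rewrite -[(size n1).+1]addn0 iotaDl all_map; apply: eq_in_all => l.
rewrite mem_iota /= add0n => hl.
rewrite (_ : (_ == size n1) = false) /=; last by apply/eqP; lia.
have e : n1 ++ m :: n2 = (n1 ++ [:: m]) ++ n2 by rewrite -catA.
have -> : ((size n1).+1 + l = size (n1 ++ [:: m]) + l)%N by rewrite size_cat addn1.
by rewrite e !blk_catR // !modn_pair.
Qed.

(** With both indices split into left, middle and right parts, the filter in [red] fixes the middle
    parts and equates the outer ones, which leaves a partial trace. The dimension is a variable [N]
    with an equation, so that the lemma applies to [2 ^ At a] without a cast. *)
Lemma red_ptrk n1 m n2 N (rho : 'M[C]_N) : N = (2 ^ sumn (n1 ++ m :: n2))%N ->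
  eqk (2 ^ m) (mxf (red (n1 ++ m :: n2) (size n1) rho m))
    (ptrk (2 ^ sumn n1) (2 ^ m) (2 ^ sumn n2) (mxf rho)).
Proof.
rewrite sumn_cat /= !expnD mulnA => eN; move: rho; rewrite {}eN => rho.
apply: eqk_ord => a b; rewrite mxfE mxE.
set P := (2 ^ sumn n1)%N; set M := (2 ^ m)%N; set Q := (2 ^ sumn n2)%N.
rewrite sum_mul_ord sum_mul_ord /ptrk /ptrL /ptrR; apply: eq_bigr => p _.
rewrite -[RHS](@sum_delta _ M a (fun x => \sum_(s < Q)
   mxf rho ((p * M + x) * Q + s)%N ((p * M + b) * Q + s)%N)) //.
apply: eq_bigr => x _; case: (x =P a :> nat) => [ex|/eqP/negPf nx]; last first.
  apply: big1 => s _; apply: big1 => v _.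
  by rewrite /= blk_at // nx.
apply: eq_bigr => s _; rewrite sum_mul_ord sum_mul_ord.
rewrite -[RHS](@sum_delta _ P p (fun p' =>
   mxf rho ((p * M + x) * Q + s)%N ((p' * M + b) * Q + s)%N)) //.
apply: eq_bigr => p' _.
transitivity (\sum_(y < M) if y == b :> nat then \sum_(s' < Q)
  if s' == s :> nat then if p' == p :> nat then
   mxf rho ((p * M + x) * Q + s)%N ((p' * M + b) * Q + s)%N else 0 else 0 else 0).
  apply: eq_bigr => y _; case: (y =P b :> nat) => [ey|/eqP/negPf ny]; last first.
    by apply: big1 => s' _; rewrite /= !blk_at // ny andbF.
  apply: eq_bigr => s' _.
  rewrite /= !blk_at // ex ey !eqxx /= blk_others //.
  rewrite -mxfE /= ex ey andbC ![_ == nat_of_ord p']eq_sym ![_ == nat_of_ord s']eq_sym.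
  by case: (s' =P s :> nat) => [->|] //=.
rewrite (@sum_delta _ M b (fun=> \sum_(s' < Q)
  if s' == s :> nat then if p' == p :> nat then
   mxf rho ((p * M + x) * Q + s)%N ((p' * M + b) * Q + s)%N else 0 else 0)) //.
by rewrite (@sum_delta _ Q s (fun=> if p' == p :> nat then
   mxf rho ((p * M + x) * Q + s)%N ((p' * M + b) * Q + s)%N else 0)).
Qed.

(** * Level gates as tensor products *)

Definition gates T (l : seq formula) : seq (nat * kernel C) :=
  [seq (At b, mxf (gate_of T b)) | b <- l].

Definition Ats (l : seq formula) : nat := sumn (map At l).

Lemma tdim_map (F : formula -> kernel C) l : tdim [seq (At b, F b) | b <- l] = (2 ^ Ats l)%N.
Proof. by rewrite /tdim /unzip1 -map_comp. Qed.

Lemma Ats_cat l1 l2 : Ats (l1 ++ l2) = (Ats l1 + Ats l2)%N.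
Proof. by rewrite /Ats map_cat sumn_cat. Qed.

Lemma Ats_step a : Ats (step a) = At a.
Proof. by case: a => //= *; rewrite /Ats /= ?addn0 ?addnA. Qed.

Lemma expand_cat l1 l2 : expand (l1 ++ l2) = expand l1 ++ expand l2.
Proof. by rewrite /expand map_cat flatten_cat. Qed.

Lemma Ats_expand l : Ats (expand l) = Ats l.
Proof.
elim: l => // a l IH; rewrite -cat1s expand_cat !Ats_cat IH.
by rewrite Ats_step.
Qed.

Lemma Ats_level a i : Ats (level a i) = At a.
Proof.
rewrite /level; elim: i.-1 => [|n IH]; first by rewrite /Ats /= addn0.
by rewrite iterS Ats_expand.
Qed.

Lemma levelS a i : (0 < i)%N -> level a i.+1 = expand (level a i).
Proof. by case: i. Qed.

(** By induction on the list: the first block is the quotient by the dimension of the tail, and the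
    other blocks depend only on the remainder. *)
Lemma prod_blk_tens (F : formula -> kernel C) l u v :
  (u < 2 ^ Ats l)%N -> (v < 2 ^ Ats l)%N ->
  \prod_(k < size l) F (nth Ff l k) (blk (map At l) k u) (blk (map At l) k v) =
  tens [seq (At b, F b) | b <- l] u v.
Proof.
elim: l u v => [|b l IH] u v hu hv; first by rewrite big_ord0.
have b0 w : (w < 2 ^ Ats (b :: l))%N ->
    blk (map At (b :: l)) 0 w = (w %/ 2 ^ Ats l)%N.
  move=> hw; rewrite /blk /= drop0 modn_small // ltn_divLR ?expn_gt0 //.
  by rewrite -expnD.
rewrite big_ord_recl /= /kron tdim_map -!b0 //; congr (@GRing.mul C _ _).
rewrite -IH ?ltn_mod ?expn_gt0 //; apply: eq_bigr => k _.
rewrite /= /bump add1n.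
rewrite !(@blk_catR [:: At b] (map At l) k) ?size_map //.
Qed.

Lemma Glev_tens T a i :
  eqk (2 ^ At a) (mxf (Glev T a i)) (tens (gates T (level a i))).
Proof.
apply: eqk_ord => u v; rewrite mxfE mxE.
by rewrite -prod_blk_tens ?Ats_level.
Qed.

Lemma unitary_Glev T a i : unitary T -> unitary (Glev T a i).
Proof.
move=> uT; apply/unitary_isometry; refine (eqk_isometry (eqk_sym (@Glev_tens T a i)) _).
have := @tens_isometry (gates T (level a i)); rewrite tdim_map Ats_level; apply.
elim: (level a i) => [|b l IH]; constructor => //.
exact/unitary_isometry/unitary_gate_of.
Qed.

Lemma mxf_red_level a i l1 b l2 (rho : 'M[C]_(2 ^ At a)) :
  level a i = l1 ++ b :: l2 ->
  eqk (2 ^ At b) (mxf (red (map At (level a i)) (size l1) rho (At b)))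
    (ptrk (2 ^ Ats l1) (2 ^ At b) (2 ^ Ats l2) (mxf rho)).
Proof.
move=> e; rewrite e map_cat /= -(size_map At l1); apply: red_ptrk.
by rewrite -(Ats_level a i) e /Ats map_cat.
Qed.

(** The level gate factors as A ⊗ gate(b) ⊗ D with [A] and [D] isometric, and the outer factors
    cancel in the partial trace. *)
Lemma ctx_gate T a i l1 b l2 (X Y : 'M[C]_(2 ^ At a)) : unitary T ->
  level a i = l1 ++ b :: l2 -> X = Glev T a i *m Y *m adj (Glev T a i) ->
  eqk (2 ^ At b) (ptrk (2 ^ Ats l1) (2 ^ At b) (2 ^ Ats l2) (mxf X))
    (conjk (2 ^ At b) (mxf (gate_of T b))
       (ptrk (2 ^ Ats l1) (2 ^ At b) (2 ^ Ats l2) (mxf Y))).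
Proof.
move=> uT e ->.
have dimE : (2 ^ At a = 2 ^ Ats l1 * 2 ^ At b * 2 ^ Ats l2)%N.
  by rewrite -(Ats_level a i) e Ats_cat /Ats /= !expnD mulnA.
have ig l : isometric (2 ^ Ats l) (tens (gates T l)).
  rewrite -(tdim_map (fun b => mxf (gate_of T b))); apply: tens_isometry.
  elim: l => [|c l IH]; constructor => //.
  exact/unitary_isometry/unitary_gate_of.
refine (eqk_trans _ (ptrk_conj _ _ (ig l1) (ig l2))).
apply: eqk_ptrk; rewrite -dimE.
refine (eqk_trans (mxf_conj _ _) _); apply: eqk_conj => //.
refine (eqk_trans (@Glev_tens T a i) _).
rewrite e /gates map_cat /=.
have := @tens_cat3 (gates T l1) (At b) (mxf (gate_of T b)) (gates T l2).
by rewrite tdim_cat tdim_cons !tdim_map mulnA -dimE.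
Qed.

(** * Density operators and inverse gates *)

Lemma mxf_dens N (A : 'M[C]_N) : densk N (mxf A) <-> density A.
Proof.
have eA : \matrix_(i, j) mxf A i j = A by apply/matrixP => i j; rewrite mxE mxfE.
have tE : trk N (mxf A) = \tr A by apply: eq_bigr => i _; rewrite mxfE.
by rewrite /densk /density tE psdk_psd eA.
Qed.

Lemma density_conj N (G X : 'M[C]_N) :
  unitary G -> density X -> density (G *m X *m adj G).
Proof.
move=> uG [pX tX]; split.
  move=> v; have := pX (adj G *m v).
  by rewrite adjv_mul adjmxK !mulmxA.
by rewrite mxtrace_mulC mulmxA unitary_adj // mul1mx.
Qed.

Lemma psd_diag_bool N (c : nat -> bool) :
  psd (\matrix_(i < N, j < N) ((i == j) && c i)%:R : 'M[C]_N).
Proof.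
by have /psdk_psd := @diag_bool_psd C N c; congr psd.
Qed.

Lemma density_TP0 T : unitary T -> density (TP0 T 1).
Proof.
move=> uT; apply: density_conj; first exact: unitary_Tn.
split; first exact: (psd_diag_bool (fun k => ~~ odd k)).
by rewrite /mxtrace !big_ord_recl big_ord0 !mxE /= !addr0.
Qed.

Lemma density_TP1 T : unitary T -> density (TP1 T 1).
Proof.
move=> uT; apply: density_conj; first exact: unitary_Tn.
split; first exact: (psd_diag_bool odd).
by rewrite /mxtrace !big_ord_recl big_ord0 !mxE /= add0r addr0.
Qed.

Lemma conjkK N (G : 'M[C]_N) (h : kernel C) : unitary G ->
  eqk N (conjk N (mxf (adj G)) (conjk N (mxf G) h)) h.
Proof.
move=> uG; have eH := @mxf_matrix N h; set H := \matrix_(i, j) _ in eH.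
refine (eqk_trans _ eH).
have e : adj G *m (G *m H *m adj G) *m adj (adj G) = H.
  by rewrite adjmxK !mulmxA unitary_adj // mul1mx -mulmxA unitary_adj // mulmx1.
rewrite -{1}e; apply: eqk_sym.
refine (eqk_trans (mxf_conj _ _) _); apply: eqk_conj => //.
refine (eqk_trans (mxf_conj _ _) _); exact: eqk_conj.
Qed.

Lemma ptrk1 N (f : kernel C) : eqk N (ptrk 1 N 1 f) f.
Proof.
by move=> a b _ _; rewrite /ptrk /ptrL /ptrR !big_ord1 !mul0n !add0n !muln1 !addn0.
Qed.

(* The meanings of the children of an occurrence are determined by its own meaning. *)
Lemma ptrk_child T a i l1 b l2 s1 c s2 (X Y : 'M[C]_(2 ^ At a)) : unitary T ->
  level a i = l1 ++ b :: l2 -> step b = s1 ++ c :: s2 ->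
  X = Glev T a i *m Y *m adj (Glev T a i) ->
  eqk (2 ^ At c)
    (ptrk (2 ^ Ats (expand l1 ++ s1)) (2 ^ At c) (2 ^ Ats (s2 ++ expand l2)) (mxf Y))
    (ptrk (2 ^ Ats s1) (2 ^ At c) (2 ^ Ats s2)
       (conjk (2 ^ At b) (mxf (adj (gate_of T b)))
          (ptrk (2 ^ Ats l1) (2 ^ At b) (2 ^ Ats l2) (mxf X)))).
Proof.
move=> uT el es eX.
have dimE : (2 ^ At b = 2 ^ Ats s1 * 2 ^ At c * 2 ^ Ats s2)%N.
  by rewrite -(Ats_step b) es Ats_cat /Ats /= !expnD mulnA.
(* The reduction to [c] is done in two stages: first to the qubits of [b], where undoing the gate of
   [b] relates [Y] to [X], then to [c] inside them. *)
rewrite !Ats_cat !Ats_expand !expnD -ptrk_ptrk -dimE.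
apply: eqk_ptrk; rewrite -dimE; apply: eqk_sym.
refine (eqk_trans (eqk_conj _ (ctx_gate uT el eX)) _); first by [].
exact/conjkK/unitary_gate_of.
Qed.

(** * Occurrences in successive levels and the height of the tree *)

Lemma expand_cons b l : expand (b :: l) = step b ++ expand l.
Proof. by []. Qed.

(** This locates the parent [b] of an occurrence [c] in the next level, together with the siblings
    [s1] and [s2]. *)
Lemma expand_split l l1 c l2 : expand l = l1 ++ c :: l2 ->
  exists m1 b m2 s1 s2, [/\ l = m1 ++ b :: m2, step b = s1 ++ c :: s2,
    l1 = expand m1 ++ s1 & l2 = s2 ++ expand m2].
Proof.
elim: l l1 => [|b l IH] l1; first by case: l1.
rewrite expand_cons.
have cat_eq (s t s' : seq formula) t' : s ++ t = s' ++ c :: t' ->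
    (exists s2, s = s' ++ c :: s2 /\ t' = s2 ++ t) \/
    (exists s1, s' = s ++ s1 /\ t = s1 ++ c :: t').
  elim: s s' => [|x s IHs] [|y s'] //=; try by move=> ->; right; eexists.
  - by case=> -> <-; left; exists s.
  - by case=> -> /IHs[[s2 [-> ->]]|[s1 [-> ->]]]; [left; exists s2|right; exists s1].
case/cat_eq => [[s2 [es ->]]|[s1 [-> /IH[m1 [b' [m2 [t1 [t2 [-> es -> ->]]]]]]]]].
  by exists [::], b, l, l1, s2; split.
exists (b :: m1), b', m2, t1, t2; split=> //.
by rewrite catA.
Qed.

Lemma iter_expand_cat n l1 l2 :
  iter n expand (l1 ++ l2) = iter n expand l1 ++ iter n expand l2.
Proof. by elim: n => //= n ->; rewrite expand_cat. Qed.

Lemma height_gt0 a : (0 < height a)%N.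
Proof. by case: a. Qed.

(** Each expansion replaces a compound formula by arguments of smaller height. *)
Lemma iter_expand_atomic n a : (height a <= n.+1)%N ->
  all is_atomic (iter n expand [:: a]).
Proof.
elim: n a => [|n IH] a; first by case: a => //= [b|b|b|b c|b c d];
  rewrite ltnS ?geq_max leqNgt height_gt0.
rewrite iterSr; case: a => [k|||b|b|b|b c|b c d] /= h;
  try by (apply: IH; rewrite /=; lia).
- rewrite (_ : expand _ = [:: b] ++ [:: c]) // iter_expand_cat all_cat !IH //; lia.
- rewrite (_ : expand _ = [:: b] ++ [:: c] ++ [:: d]) //.
  rewrite !iter_expand_cat !all_cat !IH //; lia.
Qed.

Lemma level_height_atomic a i : (height a <= i)%N -> all is_atomic (level a i).
Proof.
move=> h; apply: iter_expand_atomic; lia.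
Qed.

Lemma split_nth (l : seq formula) j : (j < size l)%N ->
  l = take j l ++ nth Ff l j :: drop j.+1 l.
Proof. by move=> h; rewrite -drop_nth // cat_take_drop. Qed.

(** * The holistic model extending the contextual meanings in g *)

Section Extension.

Variables (T : 'M[C]_2) (g : formula) (Hol : holmap).
Hypothesis uT : unitary T.
Hypothesis hol : holistic T Hol.

Definition occurs (c : formula) (p : nat * nat) : Prop :=
  pos g p.1 p.2 /\ nth Ff (level g p.1) p.2 = c.

Definition gate_image (c : formula) (l : seq (nat * kernel C)) : 'M[C]_(2 ^ At c) :=
  gate_of T c *m (\matrix_(i, j) tens l i j) *m adj (gate_of T c).

(** Whether [c] occurs in [g], and where, is decided by classical choice. An ordinary atom absent
    from [g] may have any density operator and gets that of [Ff]; absent [Ff] and [Ft] get the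
    meanings that every model must give them. *)
Fixpoint rho (c : formula) : 'M[C]_(2 ^ At c) :=
  match pselect (exists p, occurs c p) with
  | left h => let p := projT1 (cid h) in ctx Hol g p.1 p.2 (At c)
  | right _ => gate_image c
      match c with
      | Atom _ | Ff => [:: (1%N, mxf (TP0 T 1))]
      | Ft => [:: (1%N, mxf (TP1 T 1))]
      | Neg b | SqId b | SqNeg b => [:: (At b, mxf (rho b))]
      | Xr b d => [:: (At b, mxf (rho b)); (At d, mxf (rho d))]
      | Tf b d e => [:: (At b, mxf (rho b)); (At d, mxf (rho d)); (At e, mxf (rho e))]
      end
  end.

(** The list inside [rho], rephrased through [step] so that all compound formulas are treated at
    once. *)
Definition factors (c : formula) : seq (nat * kernel C) :=
  match c with
  | Atom _ | Ff => [:: (1%N, mxf (TP0 T 1))]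
  | Ft => [:: (1%N, mxf (TP1 T 1))]
  | _ => [seq (At b, mxf (rho b)) | b <- step c]
  end.

Lemma rho_occurs c i j : pos g i j -> nth Ff (level g i) j = c ->
  rho c = ctx Hol g i j (At c).
Proof.
move=> hp hn; case: hol => _ _ normal _.
have -> : rho c = match pselect (exists p, occurs c p) with
  | left h => let p := projT1 (cid h) in ctx Hol g p.1 p.2 (At c)
  | right _ => gate_image c (factors c) end by case: {hn} c.
case: pselect => [h|[]]; last by exists (i, j).
(* Normality makes the chosen occurrence immaterial. *)
by case: (cid h) => [[i' j'] [hp' hn']] /=; apply: (normal g c).
Qed.

Lemma rho_fresh c : ~ (exists p, occurs c p) -> rho c = gate_image c (factors c).
Proof.
have -> : rho c = match pselect (exists p, occurs c p) with
  | left h => let p := projT1 (cid h) in ctx Hol g p.1 p.2 (At c)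
  | right _ => gate_image c (factors c) end by case: c.
by case: pselect.
Qed.

Lemma mxf_ctx (H : holmap) a i l1 b l2 : level a i = l1 ++ b :: l2 ->
  eqk (2 ^ At b) (mxf (ctx H a i (size l1) (At b)))
    (ptrk (2 ^ Ats l1) (2 ^ At b) (2 ^ Ats l2) (mxf (H a i))).
Proof. exact: mxf_red_level. Qed.

Lemma occurs_split c : (exists p, occurs c p) ->
  exists i l1 l2, [/\ (0 < i)%N, (i <= height g)%N, level g i = l1 ++ c :: l2 &
    rho c = ctx Hol g i (size l1) (At c)].
Proof.
case=> [[i j] [/= hp hn]]; have [i0 ih jl] := hp.
exists i, (take j (level g i)), (drop j.+1 (level g i)).
split=> //; first by rewrite -hn -split_nth.
by rewrite size_takel 1?ltnW // (rho_occurs hp hn).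
Qed.

Lemma gate_image_dens c l : List.Forall (fun x => densk (2 ^ x.1) x.2) l ->
  tdim l = (2 ^ At c)%N -> density (gate_image c l).
Proof.
move=> dl el; apply: density_conj; first exact: unitary_gate_of.
apply/mxf_dens; refine (eqk_dens (eqk_sym (@mxf_matrix _ _)) _).
by rewrite -el; apply: tens_dens.
Qed.

Lemma rho_dens_factors c :
  List.Forall (fun x => densk (2 ^ x.1) x.2) (factors c) -> density (rho c).
Proof.
case: (pselect (exists p, occurs c p)) => [occ _|fresh df].
  case/occurs_split: occ => [i [l1 [l2 [i0 ih el ->]]]].
  apply/mxf_dens; refine (eqk_dens (eqk_sym (mxf_ctx Hol el)) _).
  apply: ptrk_dens.
  have -> : (2 ^ Ats l1 * 2 ^ At c * 2 ^ Ats l2 = 2 ^ At g)%N.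
    by rewrite -(Ats_level g i) el Ats_cat /Ats /= !expnD mulnA.
  by apply/mxf_dens; case: hol => d _ _ _; apply: d; rewrite i0.
rewrite (rho_fresh fresh); apply: gate_image_dens => //.
by case: c {fresh df} => * //=; rewrite /tdim /= ?addn0 ?addnA.
Qed.

Lemma rho_dens c : density (rho c).
Proof.
have d0 := density_TP0 uT; have d1 := density_TP1 uT.
elim: c => [n|||b IH|b IH|b IH|b IHb c IHc|b IHb c IHc d IHd];
  apply: rho_dens_factors => /=;
  do ?[exact: List.Forall_nil | apply: List.Forall_cons] => /=;
  exact/mxf_dens.
Qed.

(** Levels repeat atomic formulas, so an atom is its own child, with the identity as gate. *)
Lemma rho_atomic_child f s1 c s2 : is_atomic f -> step f = s1 ++ c :: s2 ->
  eqk (2 ^ At c) (mxf (rho c))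
    (ptrk (2 ^ Ats s1) (2 ^ At c) (2 ^ Ats s2)
       (conjk (2 ^ At f) (mxf (adj (gate_of T f))) (mxf (rho f)))).
Proof.
move=> af; have -> : step f = [:: f] by case: f af.
case: s1 => [|? [|//]] // [<- <-]; apply: eqk_sym.
refine (eqk_trans (ptrk1 _) _).
have g1 : mxf (adj (gate_of T f)) = mxf (1%:M : 'M_(2 ^ At f)).
  by case: f af => //= *; rewrite /adj map_scalar_mx rmorph1 tr_scalar_mx.
rewrite g1; refine (eqk_trans (eqk_sym (mxf_conj _ _)) _).
by rewrite mul1mx /adj map_scalar_mx rmorph1 tr_scalar_mx mulmx1.
Qed.

(** The consistency on which the new model rests. If [f] occurs in [g], so does its child at the
    next level, and the relation is inherited from [Hol]. Otherwise the gate cancels, and a product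
    of states reduces to its factor. *)
Lemma rho_child f s1 c s2 : step f = s1 ++ c :: s2 ->
  eqk (2 ^ At c) (mxf (rho c))
    (ptrk (2 ^ Ats s1) (2 ^ At c) (2 ^ Ats s2)
       (conjk (2 ^ At f) (mxf (adj (gate_of T f))) (mxf (rho f)))).
Proof.
move=> es; have [af|naf] := boolP (is_atomic f); first exact: rho_atomic_child.
have dimE : (2 ^ At f = 2 ^ Ats s1 * 2 ^ At c * 2 ^ Ats s2)%N.
  by rewrite -(Ats_step f) es Ats_cat /Ats /= !expnD mulnA.
case: (pselect (exists p, occurs f p)) => [|fresh].
  case/occurs_split => [i [l1 [l2 [i0 ih el ->]]]].
  (* A compound formula cannot stand in the last level, so [Hol] relates this level to the next. *)
  have ltih : (i < height g)%N.
    rewrite ltnNge; apply: contra naf => /level_height_atomic.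
    by rewrite el all_cat /= => /and3P[].
  case: hol => _ /(_ g i); rewrite i0 ltih => /(_ isT) eX _ _.
  have eS : level g i.+1 = (expand l1 ++ s1) ++ c :: (s2 ++ expand l2).
    by rewrite levelS // el expand_cat expand_cons es -!catA.
  have hp : pos g i.+1 (size (expand l1 ++ s1)).
    by split=> //; rewrite eS [X in (_ < X)%N]size_cat /= addnS ltnS leq_addr.
  rewrite (rho_occurs hp); last by rewrite eS nth_cat ltnn subnn.
  refine (eqk_trans (mxf_ctx Hol eS) _).
  refine (eqk_trans (ptrk_child uT el es eX) _).
  apply: eqk_ptrk; rewrite -dimE; apply: eqk_conj => //.
  exact/eqk_sym/mxf_ctx.
have ef : factors f = [seq (At b, mxf (rho b)) | b <- step f] by case: f naf {es dimE fresh}.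
rewrite (rho_fresh fresh) /gate_image ef es map_cat /=; apply: eqk_sym.
set L1 := [seq _ | b <- s1]; set L2 := [seq _ | b <- s2].
set X := \matrix_(i, j) _.
(* The siblings have trace one, so tracing them out leaves exactly [rho c]. *)
have dL (l : seq formula) : trk (2 ^ Ats l) (tens [seq (At b, mxf (rho b)) | b <- l]) = 1.
  suff dl : List.Forall (fun x => densk (2 ^ x.1) x.2) [seq (At b, mxf (rho b)) | b <- l].
    by have [_] := tens_dens dl; rewrite tdim_map.
  elim: l => [|b l IH] /=; first exact: List.Forall_nil.
  by apply: List.Forall_cons => //; apply/mxf_dens/rho_dens.
refine (eqk_trans _ (ptrk_kron (mxf (rho c)) (dL s1) (dL s2))).
apply: eqk_ptrk; rewrite -dimE.
refine (eqk_trans (eqk_conj _ (mxf_conj _ _)) _); first by [].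
refine (eqk_trans (conjkK _ (unitary_gate_of f uT)) _).
refine (eqk_trans (@mxf_matrix _ _) _).
have := @tens_cat3 L1 (At c) (mxf (rho c)) L2.
by rewrite tdim_cat tdim_cons !tdim_map mulnA -dimE.
Qed.

(** The state of level n + 1, counted from the root level 1: the gate with index n leads from level
    n + 1 to level n, and its inverse is applied here. *)
Fixpoint pullback (f : formula) (n : nat) : 'M[C]_(2 ^ At f) :=
  if n is n'.+1 then adj (Glev T f n) *m pullback f n' *m Glev T f n else rho f.

Lemma pullback_dens f n : density (pullback f n).
Proof.
elim: n => [|n IH] /=; first exact: rho_dens.
rewrite -[X in _ *m X]adjmxK; apply: density_conj => //.
exact/adj_unitary/unitary_Glev.
Qed.

Lemma pullback_step f n :
  pullback f n = Glev T f n.+1 *m pullback f n.+1 *m adj (Glev T f n.+1).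
Proof.
have uG := unitary_Glev f n.+1 uT.
by rewrite /= !mulmxA uG mul1mx -mulmxA uG mulmx1.
Qed.

(** By induction on the level: an occurrence and its parent are related by the same formula for the
    pulled-back states and for [rho]. *)
Lemma pullback_level f n l1 b l2 : level f n.+1 = l1 ++ b :: l2 ->
  eqk (2 ^ At b) (mxf (rho b))
    (ptrk (2 ^ Ats l1) (2 ^ At b) (2 ^ Ats l2) (mxf (pullback f n))).
Proof.
elim: n l1 b l2 => [|n IH] l1 b l2.
  case: l1 => [|? [|//]] // [<- <-]; exact/eqk_sym/ptrk1.
rewrite levelS // => /expand_split[m1 [b' [m2 [s1 [s2 [el es -> ->]]]]]].
refine (eqk_trans (rho_child es) (eqk_sym _)).
refine (eqk_trans (ptrk_child uT el es (pullback_step f n)) _).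
apply: eqk_ptrk.
have <- : (2 ^ At b' = 2 ^ Ats s1 * 2 ^ At b * 2 ^ Ats s2)%N.
  by rewrite -(Ats_step b') es Ats_cat /Ats /= !expnD mulnA.
by apply: eqk_conj => //; apply/eqk_sym/IH.
Qed.

Definition extension : holmap := fun f i => pullback f i.-1.

Lemma ctx_extension f i j b : pos f i j -> nth Ff (level f i) j = b ->
  ctx extension f i j (At b) = rho b.
Proof.
case; case: i => // i _ _ hj hn; apply: mxf_inj.
have el := split_nth hj; rewrite hn in el.
rewrite -{1}(size_takel (ltnW hj)).
refine (eqk_trans (mxf_ctx extension el) _).
exact/eqk_sym/pullback_level.
Qed.

Lemma gate_image_atomic c (X : 'M[C]_(2 ^ At c)) : gate_of T c = 1%:M ->
  gate_image c [:: (At c, mxf X)] = X.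
Proof.
move=> e; rewrite /gate_image e /adj map_scalar_mx rmorph1 tr_scalar_mx mul1mx mulmx1.
apply: mxf_inj; refine (eqk_trans (@mxf_matrix _ _) _); exact: tens_single.
Qed.

Lemma rho_Ff : rho Ff = TP0 T 1.
Proof.
have [[[i j] [hp hn]]|fresh] := pselect (exists p, occurs Ff p).
  by rewrite (rho_occurs hp hn); case: hol => _ _ _ /(_ _ _ _ hp)[/(_ hn)].
by rewrite (rho_fresh fresh) (@gate_image_atomic Ff).
Qed.

Lemma rho_Ft : rho Ft = TP1 T 1.
Proof.
have [[[i j] [hp hn]]|fresh] := pselect (exists p, occurs Ft p).
  by rewrite (rho_occurs hp hn); case: hol => _ _ _ /(_ _ _ _ hp)[_ /(_ hn)].
by rewrite (rho_fresh fresh) (@gate_image_atomic Ft).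
Qed.

(** Normality holds since the meaning of an occurrence of [b] is [rho b] at every position. *)
Lemma extension_holistic : holistic T extension.
Proof.
split=> [f i _|f [|i] // _|f b i j i' j' hp hp' hn hn'|f i j hp].
- exact: pullback_dens.
- exact: pullback_step.
- by rewrite !ctx_extension.
- split=> hn.
    by rewrite (ctx_extension hp hn) rho_Ff.
  by rewrite (ctx_extension hp hn) rho_Ft.
Qed.

End Extension.

(** * Reflexivity and transitivity of consequence *)

Theorem theorem4p16 :
  forall a b d : formula,
    consequence a a /\
    (consequence a b -> consequence b d -> consequence a d).
Proof.
move=> a b d; split.
  move=> T uT g _ _ Hol [_ _ normal _] i j i' j' hp hp' hn hn'.
  by rewrite (normal g a i j i' j').
move=> ab bd T uT g _ _ Hol hol i j i' j' hp hp' hn hn'.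
rewrite -(rho_occurs hol hp hn) -(rho_occurs hol hp' hn').
pose f := Tf a b d.
have hE := @extension_holistic T g Hol uT hol.
(* Level 2 of [f] is the list of [a], [b], [d], at positions 0, 1 and 2. *)
have pf k (hk : (k < 3)%N) : pos f 2 k.
  by split=> //=; rewrite ltnS !leq_max !height_gt0.
have sa : subf a f by apply/subf_Tf1/subf_refl.
have sb : subf b f by apply/subf_Tf2/subf_refl.
have sd : subf d f by apply/subf_Tf3/subf_refl.
have := ab T uT f sa sb _ hE 2%N 0%N 2%N 1%N (pf 0%N isT) (pf 1%N isT) erefl erefl.
have := bd T uT f sb sd _ hE 2%N 1%N 2%N 2%N (pf 1%N isT) (pf 2%N isT) erefl erefl.
rewrite (ctx_extension g uT hol (pf 0%N isT) (erefl a)).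
rewrite (ctx_extension g uT hol (pf 1%N isT) (erefl b)).
rewrite (ctx_extension g uT hol (pf 2%N isT) (erefl d)).
by move=> h2 h3; apply: le_trans h3 h2.
Qed.
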